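(* Let $n,b$ be natural numbers with $1<n<b$, let $k\ge 0$, let $\sigma$ be a permutation of $\{0,1,\ldots,k\}$, let $(d_k,d_{k-1},\ldots,d_0)_b$ be an $(n,b,\sigma)$-permutiple, and let $c_j$ be its $j$th carry. Then \[ b\,c_{j+1}-c_j = n\,d_{\sigma(j)}-d_j \] for all $0\le j\le k$.
   Context: For integers $0\le d_j<b$, $(d_k,d_{k-1},\ldots,d_0)_b$ denotes the natural number $\sum_{j=0}^k d_j b^j$ (leading zeros are allowed). For a permutation $\sigma$ of $\{0,1,\ldots,k\}$, $(d_k,\ldots,d_0)_b$ is an $(n,b,\sigma)$-permutiple if $(d_k,d_{k-1},\ldots,d_0)_b = n\,(d_{\sigma(k)},d_{\sigma(k-1)},\ldots,d_{\sigma(0)})_b$. Its carries are those of the usual single-digit multiplication of $(d_{\sigma(k)},\ldots,d_{\sigma(0)})_b$ by $n$ in base $b$: $c_0=0$ and $c_{j+1}=\left[n d_{\sigma(j)}+c_j-\lambda(n d_{\sigma(j)}+c_j)\right]/b$ for $0\le j\le k$, where $\lambda(x)$ is the least non-negative residue of $x$ modulo $b$. Since the product has $k+1$ digits, $c_{k+1}=0$. *)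

(* Defs.v *)
(* MathComp *)
From mathcomp Require Import all_boot all_order all_fingroup all_algebra.

Set Implicit Arguments.
Unset Strict Implicit.
Unset Printing Implicit Defensive.

(* (d_k, ..., d_0)_b; [d j] is the coefficient of b ^ j, so the digits are
   indexed from the least significant one. *)
Definition base_value (b k : nat) (d : 'I_k.+1 -> nat) : nat :=
  \sum_(j < k.+1) d j * b ^ j.

Definition permutiple (n b k : nat) (sigma : 'S_k.+1) (d : 'I_k.+1 -> nat)
    : Prop :=
  (forall j, d j < b) /\
  base_value b d = n * base_value b (fun j => d (sigma j)).

(* Carries of the single-digit multiplication of (e_k, ..., e_0)_b by n.
   Only the indices j <= k + 1 are meaningful: there [inord i] is the digit
   position i itself, while for i > k it is a junk value. The truncated
   subtraction and the Euclidean division are both exact. *)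
Fixpoint mul_carry (n b k : nat) (e : 'I_k.+1 -> nat) (j : nat) : nat :=
  if j is i.+1 then
    let s := n * e (inord i) + mul_carry n b e i in (s - s %% b) %/ b
  else 0.

Definition permutiple_carry (n b k : nat) (sigma : 'S_k.+1)
    (d : 'I_k.+1 -> nat) (j : nat) : nat :=
  mul_carry n b (fun i => d (sigma i)) j.

(* Main.v *)
Require Import Defs.
From mathcomp Require Import all_boot all_order all_fingroup all_algebra.
From mathcomp Require Import zify.
Import GRing.Theory.
Local Open Scope ring_scope.

(** Write [e j] for [d (sigma j)] and [c j] for the carries.  Each step of the
    multiplication is a Euclidean division
    [n * e j + c j = r j + b * c j.+1], with [r j < b], so the claim says
    exactly that the remainder [r j] is the digit [d j].

    Weighting these divisions by [b ^ j] and summing, the carries telescope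
    ([mul_carry_sum]): [n] times the value of [e] is the value of [r] plus
    [c k.+1 * b ^ k.+1].  By the permutiple hypothesis this number is also the
    value of [d].  Digits below [b] are determined by the value they represent,
    even modulo [b ^ k.+1] ([digits_uniq]), hence [r = d]. *)

Local Open Scope nat_scope.

(** The lowest digit is the residue modulo [b]; once it is removed, division
    by [b] leaves the same situation with one digit fewer. The overflow term
    [c * b ^ m] makes this uniqueness modulo [b ^ m]. *)
Lemma digits_uniq (b m c : nat) (f g : nat -> nat) :
    (forall i, f i < b) -> (forall i, g i < b) ->
    \sum_(i < m) f i * b ^ i = \sum_(i < m) g i * b ^ i + c * b ^ m ->
  forall i, i < m -> f i = g i.
Proof.
elim: m f g => [//|m IHm] f g fb gb.
have b_gt0 : 0 < b by apply: leq_ltn_trans (fb 0).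
have low (h : nat -> nat) : \sum_(i < m.+1) h i * b ^ i
           = h 0 + b * \sum_(i < m) h i.+1 * b ^ i.
  rewrite big_ord_recl expn0 muln1 big_distrr /=; congr (_ + _).
  by apply: eq_bigr => i _; rewrite /bump /= expnS mulnCA.
rewrite !low expnS mulnCA -addnA -mulnDr => eq_fg.
have eq0 : f 0 = g 0.
  move/(congr1 (modn^~ b)): eq_fg.
  by rewrite ![_ + b * _]addnC ![b * _]mulnC !modnMDl !modn_small.
move: eq_fg; rewrite eq0 => /addnI/eqP; rewrite eqn_pmul2l // => /eqP eq_tl.
by case=> [//|i]; apply: (IHm (f \o succn) (g \o succn)) eq_tl i => i /=.
Qed.

Lemma mul_carry_step (n b k : nat) (e : 'I_k.+1 -> nat) (i : nat) :
  n * e (inord i) + mul_carry n b e i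
  = (n * e (inord i) + mul_carry n b e i) %% b + b * mul_carry n b e i.+1.
Proof.
rewrite /=; set s := _ + mul_carry _ _ _ _.
have -> : s - s %% b = s %/ b * b by rewrite {1}(divn_eq s b) addnK.
by rewrite [b * _]mulnC divnK ?dvdn_mull // addnC -divn_eq.
Qed.

(** The telescoping sum: the carry out of position [i], weighted by
    [b ^ i.+1], is the carry into position [i.+1]. *)
Lemma mul_carry_sum (n b k : nat) (e : 'I_k.+1 -> nat) (m : nat) :
  n * \sum_(i < m) e (inord i) * b ^ i
  = \sum_(i < m) (n * e (inord i) + mul_carry n b e i) %% b * b ^ i
    + mul_carry n b e m * b ^ m.
Proof.
elim: m => [|m IHm]; first by rewrite !big_ord0 muln0.
rewrite !big_ord_recr mulnDr IHm expnS [LHS]/=.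
have := mul_carry_step n b k e m.
move: (mul_carry n b e m.+1) (mul_carry n b e m) => c' c.
move: (_ %% b) => r step.
have := congr1 (muln^~ (b ^ m)) step; rewrite /= !mulnDl; lia.
Qed.

Lemma base_value_inord (b k : nat) (d : 'I_k.+1 -> nat) :
  base_value b d = \sum_(i < k.+1) d (inord i) * b ^ i.
Proof. by apply: eq_bigr => i _; rewrite inord_val. Qed.

(** Both the digits [d] and the residues produced by the multiplication are
    base-[b] expansions of the same number modulo [b ^ k.+1]. *)
Lemma permutiple_digit (n b k : nat) (sigma : 'S_k.+1) (d : 'I_k.+1 -> nat)
    (j : 'I_k.+1) : permutiple n b sigma d ->
  d j = (n * d (sigma j) + permutiple_carry n b sigma d j) %% b.
Proof.
case=> d_lt; rewrite !base_value_inord.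
rewrite (mul_carry_sum n b k (fun i => d (sigma i))) => eq_val.
have b_gt0 : 0 < b by apply: leq_ltn_trans (d_lt ord0).
have := digits_uniq b k.+1 _ (fun i => d (inord i))
  (fun i => (n * d (sigma (inord i)) + permutiple_carry n b sigma d i) %% b).
move=> /(_ _ _ _ eq_val j (ltn_ord j)).
by rewrite inord_val; apply=> i; rewrite ?ltn_mod.
Qed.

Local Close Scope nat_scope.

Theorem theorem1 (n b k : nat) (hn : (1 < n)%N) (hnb : (n < b)%N)
    (sigma : 'S_k.+1) (d : 'I_k.+1 -> nat) (hd : permutiple n b sigma d)
    (j : 'I_k.+1) :
  b%:Z * (permutiple_carry n b sigma d j.+1)%:Z
    - (permutiple_carry n b sigma d j)%:Z
  = n%:Z * (d (sigma j))%:Z - (d j)%:Z.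
Proof.
have := mul_carry_step n b k (fun i => d (sigma i)) j.
rewrite inord_val -/(permutiple_carry n b sigma d j).
rewrite -/(permutiple_carry n b sigma d j.+1) -permutiple_digit //.
lia.
Qed.
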